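(* Let $G=G_1\ast G_2\ast G_3$ be a free splitting of a group $G$ where each $G_i$ is non-trivial, and let $\Phi=\prod_{i=1}^3\mathrm{Aut}(G_i)$. Then $$\mathrm{Out}(G;G_1,G_2,G_3)=(G_{1_2}\ast G_{2_3}\ast G_{3_1})\rtimes\Phi\cong G\rtimes\Phi .$$ That is, the subgroup of $\mathrm{Out}(G;G_1,G_2,G_3)$ generated by $G_{1_2},G_{2_3},G_{3_1}$ is their free product, and $\mathrm{Out}(G;G_1,G_2,G_3)$ is the semidirect product of this subgroup (normal) with $\Phi$.
   Context: $\mathrm{Out}(G;G_1,\dots,G_n)$ is the group of pure symmetric outer automorphisms of the splitting: the subgroup of $\mathrm{Out}(G)$ of those classes having a representative $\psi\in\mathrm{Aut}(G)$ such that for each $i$ there is $g_i\in G$ with $\psi(G_i)=g_i^{-1}G_ig_i$. Automorphisms act on the right, so a product $\psi\chi$ means first $\psi$, then $\chi$. For $i\neq j$, $f_{i_j}(g)$ ($g\in G_i$) is the class of the automorphism of $G$ which sends each $x\in G_j$ to $gxg^{-1}$ and fixes every $G_k$ with $k\ne j$ pointwise; $G_{i_j}=\{f_{i_j}(g):g\in G_i\}\cong G_i$. $\Phi$ is identified with the group of (classes of) factor automorphisms, i.e. those $\varphi\in\mathrm{Aut}(G)$ restricting to an automorphism of each $G_i$. The semidirect product relation is $\varphi^{-1}f_{i_j}(g)\varphi=f_{i_j}(\varphi(g))$; in $G\rtimes\Phi$ the group $\Phi$ acts on $G$ by factor automorphisms. *)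

(* Defs.v *)
From HB Require Import structures.
From mathcomp Require Import all_boot.
From mathcomp Require Import boolp classical_sets.

Set Implicit Arguments.
Unset Strict Implicit.
Unset Printing Implicit Defensive.

Local Open Scope quotient_scope.
Local Open Scope group_scope.
Local Open Scope classical_set_scope.

Notation hom := UMagmaMorphism.type.

Lemma hom_eq (G H : groupType) (f g : hom G H) : f =1 g -> f = g.
Proof.
case: f g => [f [[f1] [fM]]] [g [[g1] [gM]]] /= /funext fg.
move: f1 fM g1 gM; rewrite fg => f1 fM g1 gM.
by rewrite (Prop_irrelevance f1 g1) (Prop_irrelevance fM gM).
Qed.

Definition isomorphic (G H : groupType) : Prop :=
  exists f : hom G H, bijective f.

(* Every type carries a [choiceType] structure (classically), so [groupType]
   covers all groups and [subgroup G] all subgroups of [G]. *)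
Record subgroup (G : groupType) := Subgroup {
  elts : set G;
  subgroup_closed : group_closed [in elts] }.

Record subgroup_sort (G : groupType) (H : subgroup G) := SubgroupElt {
  elt_val : G;
  elt_valP : elt_val \in elts H }.
Coercion subgroup_sort : subgroup >-> Sortclass.

HB.instance Definition _ (G : groupType) (H : subgroup G) :=
  [isSub for @elt_val G H].
HB.instance Definition _ (G : groupType) (H : subgroup G) :=
  [Choice of H by <:].
HB.instance Definition _ (G : groupType) (H : subgroup G) :=
  SubChoice_isSubGroup.Build G (fun x => x \in elts H) H
    (subgroup_closed H).

Definition subgroup_val (G : groupType) (H : subgroup G) : hom H G := \val.

Lemma mk_subgroup_closed (G : groupType) (H : set G) :
  H 1 -> (forall x y, H x -> H y -> H (x / y)) -> group_closed [in H].
Proof.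
move=> H1 HF; split=> [|x y]; rewrite !inE ?in_setE //; exact: HF.
Qed.

Lemma im_closed (G H : groupType) (f : hom G H) : group_closed [in range f].
Proof.
apply: mk_subgroup_closed; first by exists 1; rewrite ?gmulf1.
by move=> _ _ [x _ <-] [y _ <-]; exists (x / y); rewrite ?gmulfF.
Qed.
Definition im (G H : groupType) (f : hom G H) : subgroup H :=
  Subgroup (im_closed f).

Lemma gen_closed (I : Type) (G : groupType) (A : I -> subgroup G) :
  group_closed
    [in [set x | forall K : subgroup G, (forall i, elts (A i) `<=` elts K) -> elts K x]].
Proof.
apply: mk_subgroup_closed => [K _|x y xA yA K AK].
  by have [] := subgroup_closed K; rewrite inE.
have [_ KF] := subgroup_closed K; move: (KF x y).
by rewrite !inE; apply; [exact: xA | exact: yA].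
Qed.
Definition gen (I : Type) (G : groupType) (A : I -> subgroup G) : subgroup G :=
  Subgroup (gen_closed A).

Lemma sub_gen (I : Type) (G : groupType) (A : I -> subgroup G) (i : I) :
  elts (A i) `<=` elts (gen A).
Proof. by move=> x Ax K AK; exact: (AK i). Qed.

Section Inclusion.
Variables (G : groupType) (H K : subgroup G) (HK : elts H `<=` elts K).

Lemma incl_subproof (x : H) : \val x \in elts K.
Proof. apply: mem_set; apply: HK; apply: set_mem; exact: elt_valP. Qed.
Definition incl (x : H) : K := SubgroupElt (incl_subproof x).

Lemma incl_is_morph : {morph incl : x y / x / y}.
Proof.
move=> x y; apply: val_inj; change (\val (x / y) = \val (incl x / incl y)).
by rewrite (gmulfF (subgroup_val H)) (gmulfF (subgroup_val K)).
Qed.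
HB.instance Definition _ := isGroupMorphism.Build H K incl incl_is_morph.
End Inclusion.

Arguments sub_gen {I G} A i.

Record aut (G : groupType) := Aut {
  aut_hom :> hom G G;
  aut_bij : bijective aut_hom }.

Lemma aut_eq (G : groupType) (f g : aut G) : f =1 g -> f = g.
Proof.
case: f g => [f fb] [g gb] /= /hom_eq fg; move: fb gb; rewrite fg => fb gb.
by rewrite (Prop_irrelevance fb gb).
Qed.

HB.instance Definition _ (G : groupType) := gen_eqMixin (aut G).
HB.instance Definition _ (G : groupType) := gen_choiceMixin (aut G).

Section AutGroup.
Variable G : groupType.
Implicit Types f g h : aut G.

Definition aut_one : aut G := Aut (inv_bij (fun=> erefl) : bijective (idfun : hom G G)).

(* Automorphisms act on the right: [f * g] is first [f], then [g]. *)
Definition aut_mul f g : aut G :=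
  Aut (bij_comp (aut_bij g) (aut_bij f) : bijective (g \o f : hom G G)).

Lemma aut_inv_subproof f : {g : aut G | cancel f g /\ cancel g f}.
Proof.
apply: cid; have [g fK gK] := aut_bij f.
have gF : {morph g : x y / x / y} by move=> x y; apply: (canLR fK); rewrite gmulfF !gK.
pose m := isGroupMorphism.Build G G g gF.
pose gh : hom G G := HB.pack g m.
have gb : bijective gh by exists f.
by exists (Aut gb).
Qed.
Definition aut_inv f : aut G := sval (aut_inv_subproof f).

Lemma aut_mulA : associative aut_mul.
Proof. by move=> f g h; apply: aut_eq. Qed.
Lemma aut_mul1 : left_id aut_one aut_mul.
Proof. by move=> f; apply: aut_eq. Qed.
Lemma aut_1mul : right_id aut_one aut_mul.
Proof. by move=> f; apply: aut_eq. Qed.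
Lemma aut_mulV : left_inverse aut_one aut_inv aut_mul.
Proof.
by move=> f; apply: aut_eq => x; case: (svalP (aut_inv_subproof f)) => _; apply.
Qed.
Lemma aut_Vmul : right_inverse aut_one aut_inv aut_mul.
Proof.
by move=> f; apply: aut_eq => x; case: (svalP (aut_inv_subproof f)) => + _; apply.
Qed.

HB.instance Definition _ := isGroup.Build (aut G)
  aut_mulA aut_mul1 aut_1mul aut_mulV aut_Vmul.
End AutGroup.

Section Inner.
Variables (G : groupType) (a : G).

Definition inner_fun (x : G) : G := x ^ a.
Lemma inner_is_morph : {morph inner_fun : x y / x / y}.
Proof. by move=> x y; rewrite /inner_fun conjMg conjVg. Qed.
HB.instance Definition _ := isGroupMorphism.Build G G inner_fun inner_is_morph.

Lemma inner_bij : bijective (inner_fun : hom G G).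
Proof.
exists (fun x => x ^ a^-1) => x.
  by change ((x ^ a) ^ a^-1 = x); rewrite -conjgM mulgV conjg1.
by change ((x ^ a^-1) ^ a = x); rewrite -conjgM mulVg conjg1.
Qed.
Definition inner : aut G := Aut inner_bij.
End Inner.

Section Out.
Variable G : groupType.
Implicit Types f g h : aut G.

(* [Out G] is the quotient of [aut G] by the inner automorphisms. *)
Definition out_rel f g : bool := `[< exists a : G, g = f * inner a >].

Lemma inner1 : inner (1 : G) = 1.
Proof. by apply: aut_eq => x; rewrite /= /inner_fun conjg1. Qed.
Lemma innerM (a b : G) : inner (a * b) = inner a * inner b.
Proof. by apply: aut_eq => x; rewrite /= /inner_fun conjgM. Qed.
Lemma innerV (a : G) : inner a^-1 = (inner a)^-1.
Proof. by apply: (mulgI (inner a)); rewrite mulgV -innerM mulgV inner1. Qed.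
Lemma inner_aut f (a : G) : inner a * f = f * inner (f a).
Proof. by apply: aut_eq => x; rewrite /= /inner_fun gmulfJ. Qed.

Lemma out_relxx : reflexive out_rel.
Proof. by move=> f; apply/asboolP; exists 1; rewrite inner1 mulg1. Qed.
Lemma out_rel_sym : symmetric out_rel.
Proof.
by move=> f g; apply/asboolP/asboolP => -[a ->]; exists a^-1; rewrite innerV mulgK.
Qed.
Lemma out_rel_trans : transitive out_rel.
Proof.
move=> g f h /asboolP[a ->] /asboolP[b ->]; apply/asboolP; exists (a * b).
by rewrite innerM mulgA.
Qed.
Canonical out_equiv := EquivRel out_rel out_relxx out_rel_sym out_rel_trans.

Definition Out := {eq_quot out_equiv}.
HB.instance Definition _ := EqQuotient.on Out.
HB.instance Definition _ := Choice.on Out.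

Definition out_mul (c d : Out) : Out := \pi_Out (repr c * repr d).
Definition out_one : Out := \pi_Out 1.
Definition out_inv (c : Out) : Out := \pi_Out (repr c)^-1.

Lemma out_piP f g : reflect (exists a : G, g = f * inner a) (f == g %[mod Out]).
Proof. by rewrite eqmodE; apply: asboolP. Qed.

Lemma repr_pi f : exists a : G, repr (\pi_Out f) = f * inner a.
Proof. by apply/out_piP; rewrite reprK. Qed.

Lemma out_piM f g : \pi_Out (f * g) = out_mul (\pi_Out f) (\pi_Out g).
Proof.
apply/eqP/out_piP; have [a ->] := repr_pi f; have [b ->] := repr_pi g.
by exists (g a * b); rewrite innerM !mulgA -(mulgA f) inner_aut !mulgA.
Qed.

Lemma out_piV f : \pi_Out f^-1 = out_inv (\pi_Out f).
Proof.
apply/eqP/out_piP; have [a ->] := repr_pi f; exists (f^-1 a^-1).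
by rewrite invgM -innerV inner_aut.
Qed.

Lemma out_mulA : associative out_mul.
Proof.
move=> c d e; rewrite -[c]reprK -[d]reprK -[e]reprK.
by rewrite -(out_piM (repr d)) -(out_piM (repr c)) -(out_piM (repr c)) -out_piM mulgA.
Qed.
Lemma out_mul1 : left_id out_one out_mul.
Proof. by move=> c; rewrite -[c]reprK -(out_piM 1) mul1g. Qed.
Lemma out_1mul : right_id out_one out_mul.
Proof. by move=> c; rewrite -[c]reprK -(out_piM _ 1) mulg1. Qed.
Lemma out_mulV : left_inverse out_one out_inv out_mul.
Proof. by move=> c; rewrite -[c]reprK -out_piV -out_piM mulVg. Qed.
Lemma out_Vmul : right_inverse out_one out_inv out_mul.
Proof. by move=> c; rewrite -[c]reprK -out_piV -out_piM mulgV. Qed.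

HB.instance Definition _ := isGroup.Build Out
  out_mulA out_mul1 out_1mul out_mulV out_Vmul.

Definition out (f : aut G) : Out := \pi_Out f.
Lemma out_is_morph : {morph out : f g / f / g}.
Proof. by move=> f g; rewrite /out out_piM out_piV. Qed.
HB.instance Definition _ := isGroupMorphism.Build (aut G) Out out out_is_morph.
End Out.

Section DirectProduct.
Variables (I : Type) (A : I -> groupType).

Definition dprod := forall i, A i.
HB.instance Definition _ := gen_eqMixin dprod.
HB.instance Definition _ := gen_choiceMixin dprod.

Let mul (f g : dprod) : dprod := fun i => f i * g i.
Let one : dprod := fun=> 1.
Let inv (f : dprod) : dprod := fun i => (f i)^-1.

Lemma dprod_mulA : associative mul.
Proof. by move=> f g h; apply: functional_extensionality_dep => i; exact: mulgA. Qed.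
Lemma dprod_mul1 : left_id one mul.
Proof. by move=> f; apply: functional_extensionality_dep => i; exact: mul1g. Qed.
Lemma dprod_1mul : right_id one mul.
Proof. by move=> f; apply: functional_extensionality_dep => i; exact: mulg1. Qed.
Lemma dprod_mulV : left_inverse one inv mul.
Proof. by move=> f; apply: functional_extensionality_dep => i; exact: mulVg. Qed.
Lemma dprod_Vmul : right_inverse one inv mul.
Proof. by move=> f; apply: functional_extensionality_dep => i; exact: mulgV. Qed.
HB.instance Definition _ := isGroup.Build dprod
  dprod_mulA dprod_mul1 dprod_1mul dprod_mulV dprod_Vmul.
End DirectProduct.

(* The external semidirect product [N ><| H] for a right action of [H] on [N];
   the pair [(h, n)] stands for the product [h * n], so that in it
   [h^-1 * n * h = act h n]. *)
Definition sdprod (N H : groupType) (act : hom H (aut N)) : Type := (H * N)%type.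

Section SemidirectProduct.
Variables (N H : groupType) (act : hom H (aut N)).

HB.instance Definition _ := gen_eqMixin (sdprod act).
HB.instance Definition _ := gen_choiceMixin (sdprod act).

Let mul (u v : sdprod act) : sdprod act := (u.1 * v.1, act v.1 u.2 * v.2).
Let one : sdprod act := (1, 1).
Let inv (u : sdprod act) : sdprod act := (u.1^-1, act u.1^-1 u.2^-1).

Lemma sdprod_mulA : associative mul.
Proof.
by move=> u v w; rewrite /mul /= mulgA; congr pair; rewrite !gmulfM mulgA.
Qed.
Lemma sdprod_mul1 : left_id one mul.
Proof. by case=> h n; rewrite /mul /= mul1g gmulf1 mul1g. Qed.
Lemma sdprod_1mul : right_id one mul.
Proof. by case=> h n; rewrite /mul /= !mulg1 gmulf1. Qed.
Lemma sdprod_mulV : left_inverse one inv mul.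
Proof.
case=> h n; rewrite /mul /inv /= mulVg; congr pair.
have -> : act h (act h^-1 n^-1) = (act h^-1 * act h) n^-1 by [].
by rewrite -gmulfM mulVg gmulf1 /= mulVg.
Qed.
Lemma sdprod_Vmul : right_inverse one inv mul.
Proof.
by case=> h n; rewrite /mul /inv /= mulgV -gmulfM mulgV gmulf1.
Qed.
HB.instance Definition _ := isGroup.Build (sdprod act)
  sdprod_mulA sdprod_mul1 sdprod_1mul sdprod_mulV sdprod_Vmul.
End SemidirectProduct.

(* [L] is the internal semidirect product of its subgroups [N] (normal)
   and [H]. *)
Definition is_sdprod (G : groupType) (L N H : subgroup G) : Prop :=
  [/\ elts N `<=` elts L /\ elts H `<=` elts L,
      forall n l, elts N n -> elts L l -> elts N (n ^ l),
      forall x, elts N x -> elts H x -> x = 1 &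
      forall l, elts L l -> exists n h, [/\ elts N n, elts H h & l = n * h]].

(* [P], with the homomorphisms [iota i], is the free product (the coproduct in
   the category of groups) of the [A i]. *)
Definition is_free_product (I : Type) (A : I -> groupType) (P : groupType)
    (iota : forall i, hom (A i) P) : Prop :=
  forall (H : groupType) (f : forall i, hom (A i) H),
    exists! h : hom P H, forall i (x : A i), h (iota i x) = f i x.

Record free_splitting (I : eqType) (G : groupType) := FreeSplitting {
  factor : I -> subgroup G;
  factorP : is_free_product (fun i => subgroup_val (factor i)) }.
Arguments factorP {I G} S : rename.
Coercion factor : free_splitting >-> Funclass.

Section FreeSplitting.
Variables (I : eqType) (G : groupType) (S : free_splitting I G).

Section Extension.
Variables (H : groupType) (f : forall i, hom (S i) H).
Lemma fs_ext_subproof :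
  {h : hom G H | forall i (x : S i), h (\val x) = f i x}.
Proof. by apply: cid; have [h [hP _]] := factorP S _ f; exists h. Qed.
Definition fs_ext : hom G H := sval fs_ext_subproof.
Lemma fs_extE i (x : S i) : fs_ext (\val x) = f i x.
Proof. exact: (svalP fs_ext_subproof). Qed.
End Extension.

Lemma fs_hom_eq (H : groupType) (h h' : hom G H) :
  (forall i (x : S i), h (\val x) = h' (\val x)) -> h = h'.
Proof.
move=> hh'; pose f i : hom (S i) H := h' \o subgroup_val (S i).
have [k [_ kU]] := factorP S _ f.
by rewrite -(kU h') // (kU h).
Qed.

Lemma fs_aut_eq (f g : aut G) :
  (forall i (x : S i), f (\val x) = g (\val x)) -> f = g.
Proof. by move=> fg; apply: aut_eq => x; rewrite (fs_hom_eq fg). Qed.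

(* Pure symmetric outer automorphisms; [x ^ a] is [a^-1 * x * a], so the
   right-hand side is the conjugate [a^-1 (S i) a]. *)
Definition pure_out_set : set (Out G) :=
  [set c | exists psi : aut G, c = out psi /\
     forall i, exists a : G, psi @` elts (S i) = (fun x => x ^ a) @` elts (S i)].

Lemma pure_out_closed : group_closed [in pure_out_set].
Proof.
apply: mk_subgroup_closed.
  exists 1; split; first by rewrite gmulf1.
  by move=> i; exists 1; apply: eq_imagel => x _; rewrite conjg1.
move=> _ _ [f [-> fS]] [g [-> gS]]; exists (f / g); split; first by rewrite gmulfF.
move=> i; have [a fi] := fS i; have [b gi] := gS i.
have gK x : g (g^-1 x) = x by rewrite -[RHS]/((1 : aut G) x) -(mulVg g).
have Kg x : g^-1 (g x) = x by rewrite -[RHS]/((1 : aut G) x) -(mulgV g).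
have giV : g^-1 @` elts (S i) = (fun x => x ^ (g^-1 b^-1)) @` elts (S i).
  apply/seteqP; split=> _ [x Sx <-].
    have : ((fun y => y ^ b) @` elts (S i)) (x ^ b) by exists x.
    rewrite -gi => -[y Sy gy]; exists y => //.
    by rewrite -{1}(Kg y) gy -gmulfJ -conjgM mulgV conjg1.
  have : (g @` elts (S i)) (g x) by exists x.
  rewrite gi => -[y Sy gy]; exists y => //.
  by rewrite -[x in RHS]Kg -gmulfJ -gy -conjgM mulgV conjg1.
exists ((g^-1 b^-1) * g^-1 a).
transitivity (g^-1 @` (f @` elts (S i))); first by rewrite image_comp.
rewrite fi image_comp.
transitivity ((fun x => x ^ (g^-1 a)) @` (g^-1 @` elts (S i))).
  by rewrite image_comp; apply: eq_imagel => x _ /=; rewrite gmulfJ.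
by rewrite giV image_comp; apply: eq_imagel => x _ /=; rewrite conjgM.
Qed.
Definition pure_out : subgroup (Out G) := Subgroup pure_out_closed.

Section PartialConjugation.
Variables (i j : I) (neq_ij : i != j).

Lemma fs_pconj_subproof (a : S i) k :
  {h : hom (S k) G | h =1 fun x => if k == j then \val x ^ (\val a)^-1 else \val x}.
Proof.
case: eqVneq => _; last by exists (subgroup_val (S k)).
by exists (inner (\val a)^-1 \o subgroup_val (S k)).
Qed.
Definition pconj_hom (a : S i) : hom G G :=
  fs_ext (fun k => sval (fs_pconj_subproof a k)).

Lemma pconj_homE (a : S i) k (x : S k) :
  pconj_hom a (\val x) = if k == j then \val a * \val x * (\val a)^-1 else \val x.
Proof.
rewrite /pconj_hom fs_extE (svalP (fs_pconj_subproof a k) x).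
by rewrite /conjg invgK mulgA.
Qed.

Lemma pconj_homM (a b : S i) :
  pconj_hom (a * b) = pconj_hom b \o pconj_hom a.
Proof.
apply: fs_hom_eq => k x /=; rewrite !pconj_homE.
case: eqVneq => kj; last by rewrite pconj_homE (negPf kj).
rewrite !gmulfM gmulfV /= !pconj_homE (negPf neq_ij) (introT eqP kj).
by rewrite invgM !mulgA.
Qed.
Lemma pconj_hom1 : pconj_hom 1 = idfun.
Proof.
apply: fs_hom_eq => k x /=; rewrite pconj_homE gmulf1 mul1g invg1 mulg1.
by case: ifP.
Qed.

Lemma pconj_bij (a : S i) : bijective (pconj_hom a).
Proof.
exists (pconj_hom a^-1) => x.
  by have /(congr1 (fun h : hom G G => h x)) := pconj_homM a a^-1; rewrite mulgV pconj_hom1.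
by have /(congr1 (fun h : hom G G => h x)) := pconj_homM a^-1 a; rewrite mulVg pconj_hom1.
Qed.

(* The automorphism sending each [x] in [S j] to [a * x * a^-1] and fixing
   the other factors pointwise. *)
Definition pconj_aut (a : S i) : aut G := Aut (pconj_bij a).

Lemma pconj_autM : {morph pconj_aut : a b / a * b}.
Proof. by move=> a b; apply: aut_eq => x /=; rewrite pconj_homM. Qed.
Definition pconj (a : S i) : Out G := out (pconj_aut a).
Lemma pconj_is_morph : {morph pconj : a b / a / b}.
Proof.
move=> a b; rewrite /pconj -gmulfF; congr out; apply: (mulIg (pconj_aut b)).
by rewrite -pconj_autM !divgK.
Qed.
HB.instance Definition _ := isGroupMorphism.Build (S i) (Out G) pconj pconj_is_morph.

Definition pconj_group : subgroup (Out G) := im pconj.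
End PartialConjugation.

Section FactorAut.
Definition factor_auts := dprod (fun i => aut (S i)).
Implicit Types phi psi : factor_auts.

Definition factor_hom phi : hom G G :=
  fs_ext (fun i => subgroup_val (S i) \o phi i).

Lemma factor_homE phi i (x : S i) : factor_hom phi (\val x) = \val (phi i x).
Proof. exact: fs_extE. Qed.
Lemma factor_homM phi psi :
  factor_hom (phi * psi) = factor_hom psi \o factor_hom phi.
Proof. by apply: fs_hom_eq => i x /=; rewrite !factor_homE. Qed.
Lemma factor_hom1 : factor_hom 1 = idfun.
Proof. by apply: fs_hom_eq => i x /=; rewrite factor_homE. Qed.

Lemma factor_bij phi : bijective (factor_hom phi).
Proof.
exists (factor_hom phi^-1) => x.
  by have /(congr1 (fun h : hom G G => h x)) := factor_homM phi phi^-1;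
    rewrite mulgV factor_hom1.
by have /(congr1 (fun h : hom G G => h x)) := factor_homM phi^-1 phi;
  rewrite mulVg factor_hom1.
Qed.

(* The factor automorphism of [G] restricting to [phi i] on each [S i]. *)
Definition factor_aut phi : aut G := Aut (factor_bij phi).
Lemma factor_aut_is_morph : {morph factor_aut : phi psi / phi / psi}.
Proof.
move=> phi psi; apply: (mulIg (factor_aut psi)); rewrite divgK.
apply: aut_eq => x; rewrite -[in RHS](divgK psi phi).
by rewrite /= (factor_homM (phi / psi) psi).
Qed.
HB.instance Definition _ :=
  isGroupMorphism.Build factor_auts (aut G) factor_aut factor_aut_is_morph.

Definition factor_act : hom factor_auts (aut G) := factor_aut.
Definition factor_out : hom factor_auts (Out G) := @out G \o factor_act.
End FactorAut.

End FreeSplitting.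

(* [ordS] is the cyclic successor: the pairs [(i, ordS i)] are (0,1), (1,2), (2,0). *)
Lemma ordS_neq (i : 'I_3) : i != ordS i.
Proof. by case: i => [[|[|[|]]]]. Qed.

(* Main.v *)
Require Import Defs.
From HB Require Import structures.
From mathcomp Require Import all_boot.
From mathcomp Require Import boolp classical_sets.
From mathcomp Require Import zify.

(* For a pure symmetric [psi] with [psi (S i) = S i ^ x i], consider the three
   points fixed by the [S i ^ x i] in the Bass-Serre tree of the splitting, and
   make the sum of their distances to the base point (the lengths of the [x i])
   minimal by inner automorphisms and by partial conjugations from the three
   chosen families. At a minimum the equivariant map of trees induced by [psi] is
   locally injective; as it is onto, all [x i] are trivial and [psi] is a factor
   automorphism. This gives generation. Conversely, along a reduced word in the
   three families, each letter puts the point of its factor strictly between the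
   two other ones, so a nonempty word is never a factor automorphism modulo inner
   ones: the map from [G] to [Out G] given by the three families is injective,
   even modulo the factor automorphisms. *)

Set Implicit Arguments.
Unset Strict Implicit.
Unset Printing Implicit Defensive.

Local Open Scope group_scope.

(** * The group of permutations of a type *)

Record permutation (T : Type) := Permutation {
  perm_fun :> T -> T;
  perm_bij : bijective perm_fun }.

Lemma permutation_eq (T : Type) (f g : permutation T) : f =1 g -> f = g.
Proof.
case: f g => [f fb] [g gb] /= /funext fg; move: fb gb; rewrite fg => fb gb.
by rewrite (Prop_irrelevance fb gb).
Qed.

HB.instance Definition _ (T : Type) := gen_eqMixin (permutation T).
HB.instance Definition _ (T : Type) := gen_choiceMixin (permutation T).

Section PermutationGroup.
Variable T : Type.
Implicit Types f g h : permutation T.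

Definition permutation_one : permutation T :=
  Permutation (inv_bij (fun=> erefl) : bijective idfun).
(** The right factor acts first, contrary to [aut_mul], so that left multiplication on words becomes
    a homomorphism. *)
Definition permutation_mul f g : permutation T :=
  Permutation (bij_comp (perm_bij f) (perm_bij g)).
Lemma permutation_inv_subproof f : {g : permutation T | cancel f g /\ cancel g f}.
Proof.
by apply: cid; have [g fK gK] := perm_bij f; exists (Permutation (Bijective gK fK)).
Qed.
Definition permutation_inv f := sval (permutation_inv_subproof f).

Lemma permutation_mulA : associative permutation_mul.
Proof. by move=> f g h; apply: permutation_eq. Qed.
Lemma permutation_mul1 : left_id permutation_one permutation_mul.
Proof. by move=> f; apply: permutation_eq. Qed.
Lemma permutation_1mul : right_id permutation_one permutation_mul.
Proof. by move=> f; apply: permutation_eq. Qed.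
Lemma permutation_mulV : left_inverse permutation_one permutation_inv permutation_mul.
Proof.
by move=> f; apply: permutation_eq => x;
  case: (svalP (permutation_inv_subproof f)) => + _; apply.
Qed.
Lemma permutation_Vmul : right_inverse permutation_one permutation_inv permutation_mul.
Proof.
by move=> f; apply: permutation_eq => x;
  case: (svalP (permutation_inv_subproof f)) => _; apply.
Qed.
HB.instance Definition _ := isGroup.Build (permutation T)
  permutation_mulA permutation_mul1 permutation_1mul permutation_mulV permutation_Vmul.
End PermutationGroup.

(** * Homomorphisms from multiplicative maps, and membership in subgroups *)

Lemma invg_neq1 (G : groupType) (x : G) : x <> 1 -> x^-1 <> 1.
Proof. by move=> x1 /eqP; rewrite invg_eq1 => /eqP. Qed.

Section MakeHom.
Variables (G H : groupType) (f : G -> H).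
Hypothesis fM : {morph f : x y / x * y}.

Lemma mulg_morph_div : {morph f : x y / x / y}.
Proof. by move=> x y; apply: (mulIg (f y)); rewrite -fM !divgK. Qed.
Definition hom_of_mul : hom G H := HB.pack f (isGroupMorphism.Build G H f mulg_morph_div).
End MakeHom.

Section SubgroupMembership.
Variables (G : groupType) (H : subgroup G).

Lemma subgroup1 : elts H 1.
Proof. by have [] := subgroup_closed H; rewrite inE. Qed.
Lemma subgroupF x y : elts H x -> elts H y -> elts H (x / y).
Proof.
by move=> Hx Hy; have [_ /(_ x y)] := subgroup_closed H; rewrite !inE; apply.
Qed.
Lemma subgroupV x : elts H x -> elts H x^-1.
Proof. by move=> Hx; rewrite -div1g; apply: subgroupF => //; apply: subgroup1. Qed.
Lemma subgroupM x y : elts H x -> elts H y -> elts H (x * y).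
Proof. by move=> Hx Hy; rewrite -(invgK y); apply/subgroupF/subgroupV. Qed.
Lemma subgroupJ x y : elts H x -> elts H y -> elts H (x ^ y).
Proof. by move=> Hx Hy; rewrite conjgE; do !apply: subgroupM => //; apply: subgroupV. Qed.
Lemma subgroupJr x y : elts H y -> elts H (x ^ y) <-> elts H x.
Proof.
move=> Hy; split=> [Hxy|Hx]; last exact: subgroupJ.
by rewrite -(conjgK y x); apply: subgroupJ => //; apply: subgroupV.
Qed.
Lemma eltsP x : elts H x -> {y : H | \val y = x}.
Proof. by move=> Hx; exists (SubgroupElt (mem_set Hx)). Qed.
Lemma elts_val (x : H) : elts H (\val x).
Proof. exact: set_mem (elt_valP x). Qed.
End SubgroupMembership.

(** * Normal forms in a free product *)

Section NormalForm.
Variables (I : eqType) (G : groupType) (S : free_splitting I G).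

(** The elements whose left translation preserves and reflects [P] form a subgroup [K] containing
    every factor. The universal property gives a map [G -> K] whose composite with the inclusion is
    the identity, so [K] is all of [G]. *)
Lemma splitting_ind (P : G -> Prop) :
  P 1 -> (forall i x g, elts (S i) x -> P g -> P (x * g)) -> forall g, P g.
Proof.
move=> P1 PM g.
pose A := [set x | forall h, P h <-> P (x * h)]%classic.
have A1 : A 1 by move=> h; rewrite mul1g.
have AF x y : A x -> A y -> A (x / y).
  by move=> Ax Ay h; rewrite -mulgA -Ax (Ay (y^-1 * h)) mulVKg.
pose K := Subgroup (mk_subgroup_closed A1 AF).
have SK i : (elts (S i) `<=` elts K)%classic.
  move=> x Sx h; split; first exact: (PM i).
  by move=> /(PM i _ _ (subgroupV Sx)); rewrite mulKg.
pose r : hom G K := fs_ext (fun i => incl (SK i) : hom _ _).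
have rE : (subgroup_val K \o r : hom G G) = (idfun : hom G G).
  apply: fs_hom_eq => i x.
  exact: (congr1 \val (fs_extE (fun i => incl (SK i) : hom _ _) x)).
have : A g by rewrite -[g]/((idfun : hom G G) g) -rE; exact: (elts_val (r g)).
by move=> /(_ 1); rewrite mulg1 => <-.
Qed.

Fixpoint reduced (o : option I) (s : seq (I * G)) : bool :=
  if s is (i, x) :: s' then
    [&& Some i != o, x \in elts (S i), x != 1 & reduced (Some i) s']
  else true.

Definition eval (s : seq (I * G)) : G := foldr (fun l g => l.2 * g) 1 s.

Definition cons_letter (i : I) (x : G) (s : seq (I * G)) :=
  if x == 1 then s else (i, x) :: s.
Definition mul_letter (i : I) (x : G) (s : seq (I * G)) :=
  if s is (k, y) :: s' then
    if k == i then cons_letter i (x * y) s' else cons_letter i x s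
  else cons_letter i x s.

Lemma reduced_None o s : reduced o s -> reduced None s.
Proof. by case: s => [//|[i x] s] /= /and4P[_ -> -> ->]. Qed.

Lemma reduced_mul_letter i x s :
  elts (S i) x -> reduced None s -> reduced None (mul_letter i x s).
Proof.
move=> /mem_set Sx; case: s => [_|[k y] s] /=; rewrite /cons_letter.
  by case: eqVneq => //= ->; rewrite Sx.
case: (eqVneq k i) => [->|ki] /and3P[Sy y1 sr].
  case: eqVneq => [_|xy1]; first exact: reduced_None sr.
  by rewrite /= xy1 sr mem_set //; apply: subgroupM; exact: set_mem.
case: eqVneq => [_|x1] /=; first by rewrite Sy y1.
by rewrite Sx Sy x1 y1 sr (inj_eq Some_inj) ki.
Qed.

Lemma mul_letterM i x y s : reduced None s ->
  mul_letter i (x * y) s = mul_letter i x (mul_letter i y s).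
Proof.
have consE z t : reduced (Some i) t -> mul_letter i z t = cons_letter i z t.
  by case: t => [//|[k u] t] /= /and4P[]; rewrite (inj_eq Some_inj) => /negPf ->.
have consM z t u : reduced (Some i) t ->
    mul_letter i z (cons_letter i u t) = cons_letter i (z * u) t.
  rewrite {1}/cons_letter; case: eqVneq => [-> tr|_ _ /=]; last by rewrite eqxx.
  by rewrite consE // mulg1.
case: s => [_|[k u] s] /=; first by rewrite consM.
case: (eqVneq k i) => [->|ki] /and3P[Su u1 sr]; first by rewrite consM ?mulgA.
by rewrite consM //= (inj_eq Some_inj) ki Su u1.
Qed.

Lemma mul_letter1 i s : reduced None s -> mul_letter i 1 s = s.
Proof.
case: s => [_|[k y] s] /=; first by rewrite /cons_letter eqxx.
case: (eqVneq k i) => [->|_] /and3P[_ y1 _]; rewrite /cons_letter ?eqxx // mul1g.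
by rewrite (negPf y1).
Qed.

Definition word := {s : seq (I * G) | reduced None s}.
Definition word_nil : word := exist (reduced None) [::] isT.

Definition word_mul i (x : S i) (w : word) : word :=
  exist (reduced None) _ (reduced_mul_letter (elts_val x) (svalP w)).

Lemma word_mulM i (x y : S i) w : word_mul (x * y) w = word_mul x (word_mul y w).
Proof.
by apply: val_inj; rewrite /= -mul_letterM ?(svalP w).
Qed.
Lemma word_mul1 i w : word_mul (1 : S i) w = w.
Proof.
by apply: val_inj; rewrite /= -[RHS](@mul_letter1 i) ?(svalP w).
Qed.

Lemma word_mul_bij i (x : S i) : bijective (word_mul x).
Proof.
by exists (word_mul x^-1) => w; rewrite -word_mulM ?mulVg ?mulgV word_mul1.
Qed.
Definition word_perm i (x : S i) := Permutation (word_mul_bij x).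
Lemma word_permM i : {morph @word_perm i : x y / x * y}.
Proof. by move=> x y; apply: permutation_eq => w; exact: word_mulM. Qed.

(* Van der Waerden's trick: [G] acts on reduced words. *)
Definition word_act : hom G (permutation word) :=
  fs_ext (fun i => hom_of_mul (@word_permM i)).

Lemma word_actE i x w : elts (S i) x ->
  sval (word_act x w) = mul_letter i x (sval w).
Proof. by move=> /eltsP[y <-]; rewrite /word_act fs_extE. Qed.

(** Uniqueness of normal forms: the action on the empty word recovers a reduced word from its
    value. *)
Lemma word_act_eval o s : reduced o s -> sval (word_act (eval s) word_nil) = s.
Proof.
elim: s o => [|[i x] s IHs] o /=; first by rewrite gmulf1.
case/and4P=> _ /set_mem Sx x1 sr; rewrite gmulfM /= (@word_actE i) //.
rewrite (IHs _ sr); case: s sr {IHs} => [_|[k y] s] /=.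
  by rewrite /cons_letter (negPf x1).
by case/and4P; rewrite (inj_eq Some_inj) => /negPf -> _ _ _; rewrite /cons_letter (negPf x1).
Qed.

(** Existence of normal forms, by taking [w] empty. *)
Lemma eval_word_act g w : eval (sval (word_act g w)) = g * eval (sval w).
Proof.
move: g w; apply: splitting_ind => [|i x g Sx IHg] w; first by rewrite gmulf1 mul1g.
rewrite gmulfM /= (@word_actE i) // -mulgA -IHg.
case: (sval _) => [|[k y] s] /=; rewrite /cons_letter.
  by case: (eqVneq x 1) => [->|//]; rewrite mul1g.
case: (eqVneq k i) => _.
  by rewrite mulgA; case: (eqVneq (x * y) 1) => [->|//]; rewrite mul1g.
by case: (eqVneq x 1) => [->|//]; rewrite mul1g.
Qed.

(* [seg o p n g]: the normal form of [g] has [n] letters, its first one is not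
   in the factor [o] and its last one is not in the factor [p]; [None] imposes
   no condition, while the empty word is only allowed between distinct factors. *)
Inductive seg : option I -> option I -> nat -> G -> Prop :=
| seg0 o p : (o != p) || (o == None) -> seg o p 0 1
| segS o p i n x g : Some i != o -> elts (S i) x -> x <> 1 ->
    seg (Some i) p n g -> seg o p n.+1 (x * g).

Definition len (g : G) : nat := size (sval (word_act g word_nil)).

Lemma seg_reduced o p n g : seg o p n g ->
  exists2 s, reduced o s & eval s = g /\ size s = n.
Proof.
elim=> {o p n g} [o p _|o p i n x g io Sx x1 _ [s sr [<- <-]]]; first by exists [::].
exists ((i, x) :: s) => //=; rewrite io sr mem_set // andbT /=; exact/eqP.
Qed.

Lemma seg_len o p n g : seg o p n g -> len g = n.
Proof. by case/seg_reduced => s /word_act_eval sE [<- <-]; rewrite /len sE. Qed.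

Lemma len_seg g : seg None None (len g) g.
Proof.
have reduced_seg o s : reduced o s -> seg o None (size s) (eval s).
  elim: s o => [|[i x] s IHs] o /=; first by move=> _; apply: seg0; case: o.
  by case/and4P=> io /set_mem Sx /eqP x1 sr; apply: (@segS _ _ i) => //; apply: IHs.
have := eval_word_act g word_nil; rewrite mulg1 => {2}<-.
exact: reduced_seg (svalP (word_act g word_nil)).
Qed.

Lemma seg_None o p n g : seg o p n g -> seg None p n g.
Proof.
case=> {o p n g} [o p _|o p i n x g _ Sx x1 sg]; first by apply: seg0; rewrite orbT.
exact: (@segS _ _ i).
Qed.

(** Neither neighbour of the letter [x] is in the factor [k], so nothing cancels or merges. *)
Lemma seg_cat o k p n m g x h : seg o (Some k) n g -> elts (S k) x -> x <> 1 ->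
  seg (Some k) p m h -> seg o p (n + m).+1 (g * x * h).
Proof.
move=> + Sx x1 sh; move E: (Some k) => q sg.
elim: sg E => {o q n g} [o q oq|o q i n y g io Sy y1 _ IHg] qk.
  rewrite mul1g; apply: (@segS _ _ k) => //.
  by move: oq; rewrite -qk eq_sym; case: eqVneq => //= <-.
by rewrite -!mulgA addSn; apply: (@segS _ _ i) => //; rewrite mulgA; exact: IHg.
Qed.

Lemma seg_inv o p n g : seg o p n g -> seg p o n g^-1.
Proof.
elim=> {o p n g} [o p op|o p i n x g io Sx x1 _ IHg].
  by rewrite invg1; apply: seg0; move: op; rewrite eq_sym; case: eqVneq => //= ->.
rewrite invgM -[_ * _]mulg1 -(addn0 n); apply: (@seg_cat _ i) => //.
- exact: subgroupV.
- exact: invg_neq1.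
- by apply: seg0; rewrite io.
Qed.

Lemma seg_first o p n g : seg o p n.+1 g -> exists i x h,
  [/\ elts (S i) x, x <> 1, Some i != o, seg (Some i) p n h & g = x * h].
Proof.
move E: n.+1 => m sg; case: sg E => // {o p m g} o p i m x h io Sx x1 sh [->].
by exists i, x, h.
Qed.

Lemma seg_last o p n g : seg o p n.+1 g -> exists i x h,
  [/\ elts (S i) x, x <> 1, Some i != p, seg o (Some i) n h & g = h * x].
Proof.
move=> /seg_inv /seg_first[i [x [h [Sx x1 ip sh gE]]]].
exists i, x^-1, h^-1; split=> //; first exact: subgroupV.
- exact: invg_neq1.
- exact: seg_inv.
- by rewrite -invgM -gE invgK.
Qed.

Lemma seg_letter o p i x : elts (S i) x -> x <> 1 -> Some i != o -> Some i != p ->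
  seg o p 1 x.
Proof.
by move=> Sx x1 io ip; rewrite -(mulg1 x); apply: (@segS _ _ i) => //; apply: seg0; rewrite ip.
Qed.

Lemma seg_size0 o p g : seg o p 0 g -> g = 1.
Proof. by move E: 0 => n sg; case: sg E. Qed.

Lemma len_eq0 g : len g = 0 -> g = 1.
Proof. by move=> g0; apply: (@seg_size0 None None); rewrite -g0; exact: len_seg. Qed.

Lemma len_mul_letter i g x : elts (S i) x -> len (g * x) <= (len g).+1.
Proof.
move=> Sx; have [->|/eqP x1] := eqVneq x 1; first by rewrite mulg1.
have := len_seg g; case E: (len g) => [|n].
  by move=> /seg_size0 ->; rewrite mul1g (@seg_len None None 1) //; apply: (@seg_letter _ _ i).
case/seg_last=> k [y [h [Sy y1 _ sh ->]]].
have [ki|ki] := eqVneq k i.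
  subst k; have [xy|/eqP xy] := eqVneq (y * x) 1.
    by rewrite -mulgA xy mulg1 (seg_len sh); lia.
  rewrite -mulgA (@seg_len None None n.+1) //; rewrite -[h * _]mulg1 -(addn0 n).
  apply: (@seg_cat _ i) => //; [exact: subgroupM|exact: seg0].
rewrite (@seg_len None None n.+2) // -(addn1 n); apply: (@seg_cat _ k) => //.
by apply: (@seg_letter _ _ i) => //; rewrite (inj_eq Some_inj) eq_sym.
Qed.

(** Here [h] is the shortest representative of the coset of [S i] containing [g]; this coset is what
    determines the vertex fixed by [S i ^ g]. *)
Lemma seg_strip i g : exists x h,
  [/\ elts (S i) x, g = x * h, seg (Some i) None (len h) h & len h < len g \/ x = 1].
Proof.
have := len_seg g; case E: (len g) => [|n] sg.
  exists 1, 1; rewrite (seg_size0 sg) mulg1; split=> //; first exact: subgroup1.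
    by rewrite (@seg_len (Some i) None 0); apply: seg0.
  by right.
have [k [x [h [Sx x1 _ sh ->]]]] := seg_first sg.
have [ki|ki] := eqVneq k i; last first.
  exists 1, (x * h); rewrite mul1g; split; [exact: subgroup1|by []| |by right].
  by rewrite (@seg_len None None n.+1); apply: (@segS _ _ k) => //;
    apply: contra ki => /eqP[->].
by subst k; exists x, h; rewrite (seg_len sh); split=> //; left.
Qed.

Lemma len_letter i x : elts (S i) x -> x <> 1 -> len x = 1%N.
Proof. by move=> Sx x1; apply: (@seg_len None None); apply: (@seg_letter _ _ i). Qed.

(** Write [z = c * h] with [c] in [S i] and [h] not beginning in [S i]. Then [h^-1 * a ^ c * h] is
    reduced of length [2 * len h + 1], while an element of [S i] has length at most one. *)
Lemma malnormal i a z : elts (S i) a -> a <> 1 -> elts (S i) (a ^ z) -> elts (S i) z.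
Proof.
move=> Sa a1; have [c [h [Sc -> sh _]]] := seg_strip i z; rewrite conjgM => Sach.
have ac1 : a ^ c <> 1 by apply/eqP; rewrite conjg_eq1; apply/eqP.
have ach1 : (a ^ c) ^ h <> 1 by apply/eqP; rewrite conjg_eq1; apply/eqP.
have := seg_cat (seg_inv sh) (subgroupJ Sa Sc) ac1 sh.
rewrite -mulgA -conjgE => /seg_len; rewrite (len_letter Sach ach1) => h0.
by rewrite (@len_eq0 h) ?mulg1 //; lia.
Qed.

Lemma len1 : len 1 = 0.
Proof. by apply: (@seg_len None None); apply: seg0. Qed.

(** The normal form of [y = x^-1 * g] has at least [n] letters and does not end in [S j]. As [y] is
    in [S j], a nontrivial [y] would make [y * y^-1] reduced and nonempty. *)
Lemma seg_mul_letters i j n g x y : seg (Some i) (Some j) n g ->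
  elts (S i) x -> elts (S j) y -> g = x * y -> n = 0.
Proof.
move=> sg Sx Sy gE.
have [m nm sy] : exists2 m, n <= m & seg None (Some j) m y.
  have [x1|/eqP x1] := eqVneq x 1.
    by exists n => //; move: sg; rewrite gE x1 mul1g => /seg_None.
  exists n.+1 => //; rewrite -(mulKg x y) -gE; apply: (@segS _ _ i) => //.
    exact: subgroupV.
  exact: invg_neq1.
apply/eqP; rewrite -leqn0; apply: leq_trans nm _; rewrite leqn0; apply/eqP.
have [y1|/eqP y1] := eqVneq y 1; first by rewrite -(seg_len sy) y1 len1.
have := seg_cat sy (subgroupV Sy) (invg_neq1 y1) (seg0 (o := Some j) (p := None) isT).
by rewrite mulgV mul1g => /seg_len; rewrite len1.
Qed.

Lemma factor_inter i j x : i != j -> elts (S i) x -> elts (S j) x -> x = 1.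
Proof.
move=> ij Si Sj; have [//|/eqP x1] := eqVneq x 1.
have : seg None None 2 (x * x^-1).
  apply: (@segS _ _ i) => //; apply: (@seg_letter _ _ j) => //.
  - exact: subgroupV.
  - exact: invg_neq1.
  - by rewrite (inj_eq Some_inj) eq_sym.
by rewrite mulgV => /seg_len; rewrite len1.
Qed.

(* One folding step between the points of the Bass-Serre tree fixed by the
   conjugates [S i ^ x] and [S j ^ y]. *)
Lemma fold_pair i j x y : i != j ->
  seg (Some i) None (len x) x -> seg (Some j) None (len y) y ->
  [\/ exists n, seg (Some i) (Some j) n (x * y^-1),
      exists k u, [/\ elts (S k) u, len (x * u^-1) < len x & len (y * u^-1) < len y],
      x = 1 /\ exists2 u, elts (S i) u & len (y * u^-1) < len y |
      y = 1 /\ exists2 u, elts (S j) u & len (x * u^-1) < len x].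
Proof.
move=> ij; case Ex: (len x) => [|n] sx; case Ey: (len y) => [|m] sy.
- apply: Or41; exists 0; rewrite (seg_size0 sx) (seg_size0 sy) mul1g invg1.
  by apply: seg0; rewrite (inj_eq Some_inj) ij.
- rewrite (seg_size0 sx); have [k [u [h [Su u1 _ sh ->]]]] := seg_last sy.
  have [ki|ki] := eqVneq k i.
    by subst k; apply: Or43; split=> //; exists u; rewrite ?mulgK ?(seg_len sh).
  apply: Or41; exists m.+1; rewrite mul1g invgM; apply: (@segS _ _ k) => //.
  + exact: subgroupV.
  + exact: invg_neq1.
  + exact: seg_inv.
- rewrite (seg_size0 sy); have [k [u [h [Su u1 _ sh ->]]]] := seg_last sx.
  have [kj|kj] := eqVneq k j.
    by subst k; apply: Or44; split=> //; exists u; rewrite ?mulgK ?(seg_len sh).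
  apply: Or41; exists (n + 0).+1; rewrite invg1; apply: (@seg_cat _ k) => //.
  by apply: seg0; rewrite (inj_eq Some_inj) kj.
have [k [u [h [Su u1 _ sh ->]]]] := seg_last sx.
have [l [v [w [Sv v1 _ sw ->]]]] := seg_last sy.
have Sv' := subgroupV Sv; have sw' := seg_inv sw.
(* Last letters from different factors do not interact. Equal last letters are removed from both
   words at once; distinct ones from the same factor merge into the nontrivial letter [u * v^-1]. *)
have [kl|kl] := eqVneq k l; last first.
  apply: Or41; exists (n + m.+1).+1; rewrite invgM; apply: (@seg_cat _ k) => //.
  apply: (@segS _ _ l) => //; last exact: invg_neq1.
  by rewrite (inj_eq Some_inj) eq_sym.
subst l; have [uv|/eqP uv] := eqVneq u v.
  subst v; apply: Or42; exists k, u.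
  by rewrite !mulgK (seg_len sh) (seg_len sw).
apply: Or41; exists (n + m).+1; rewrite invgM mulgA -(mulgA h).
apply: (@seg_cat _ k) => //; first exact: subgroupM.
by move=> /divg1_eq.
Qed.
End NormalForm.

(** * Frames: the conjugators attached to a pure symmetric automorphism *)

Section Frames.
Variables (I : eqType) (G : groupType) (S : free_splitting I G).
Implicit Types (psi : aut G) (x y : I -> G).

(* As [psi] is bijective, this says that [psi] maps [S i] onto [S i ^ x i]. *)
Definition frame psi x :=
  forall i a, elts (S i) a <-> elts (S i) (psi a ^ (x i)^-1).

Lemma frame_ext psi x y : x =1 y -> frame psi x -> frame psi y.
Proof. by move=> xy fx i a; rewrite -xy. Qed.

Lemma frame_mul f psi x y : frame f y -> frame psi x ->
  frame (f * psi) (fun i => x i * psi (y i)).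
Proof.
move=> fy px i a; apply: iff_trans (fy i a) _; apply: iff_trans (px i _) _.
by rewrite gmulfJ gmulfV -conjgM -invgM.
Qed.

Lemma frame_inner psi x u : frame psi x -> frame (psi * inner u) (fun i => x i * u).
Proof.
by move=> px i a; apply: iff_trans (px i a) _; rewrite /= /inner_fun -conjgM invgM mulVKg.
Qed.

(** Only the coset of [S i] containing [x i] matters, since [S i] normalizes itself. *)
Lemma frame_shift psi x c : (forall i, elts (S i) (c i)) -> frame psi x ->
  frame psi (fun i => c i * x i).
Proof.
move=> Sc px i a; apply: iff_trans (px i a) _; rewrite invgM conjgM.
apply: iff_sym; apply: subgroupJr; apply: (subgroupV (Sc i)).
Qed.

Lemma frame_of psi x :
  (forall i a, elts (S i) a -> elts (S i) (psi a ^ (x i)^-1)) ->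
  (forall i b, elts (S i) b -> exists2 a, elts (S i) a & psi a = b ^ x i) ->
  frame psi x.
Proof.
move=> px px' i a; split=> [|/px'[b Sb]]; first exact: px.
by rewrite -conjgM mulVg conjg1 => /(bij_inj (aut_bij psi)) <-.
Qed.

Lemma frameP psi x : frame psi x <->
  forall i, (psi @` elts (S i) = (fun b => b ^ x i) @` elts (S i))%classic.
Proof.
split=> [px i|px].
  apply/seteqP; split=> _ [a Sa <-].
    by exists (psi a ^ (x i)^-1); [exact: (px i a).1|rewrite -conjgM mulVg conjg1].
  have [f fK Kf] := aut_bij psi; exists (f (a ^ x i)) => //.
  by apply: (px i _).2; rewrite Kf -conjgM mulgV conjg1.
apply: frame_of => i a Sa.
  have : (psi @` elts (S i))%classic (psi a) by exists a.
  by rewrite px => -[b Sb <-]; rewrite -conjgM mulgV conjg1.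
have : ((fun b => b ^ x i) @` elts (S i))%classic (a ^ x i) by exists a.
by rewrite -px => -[b Sb <-]; exists b.
Qed.

Lemma pure_outP c : elts (pure_out S) c <-> exists psi x, c = out psi /\ frame psi x.
Proof.
split=> [[psi [-> /boolp.choice[x /frameP px]]]|[psi [x [-> /frameP px]]]].
  by exists psi, x.
by exists psi; split=> // i; exists (x i).
Qed.

Lemma frame_factor (phi : factor_auts S) : frame (factor_aut phi) (fun=> 1).
Proof.
apply: frame_of => i _ /eltsP[a <-].
  by rewrite /= factor_homE invg1 conjg1; exact: elts_val.
have [f fK Kf] := aut_bij (phi i); exists (\val (f a)); first exact: elts_val.
by rewrite /= factor_homE Kf conjg1.
Qed.

Lemma frame_pconj i j (ij : i != j) (c : S i) :
  frame (pconj_aut ij c) (fun k => if k == j then (\val c)^-1 else 1).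
Proof.
apply: frame_of => k _ /eltsP[a <-] /=.
  rewrite pconj_homE; case: ifP => _; last by rewrite invg1 conjg1; exact: elts_val.
  by rewrite invgK conjgE !mulgA mulVg mul1g mulgVK; exact: elts_val.
exists (\val a); first exact: elts_val.
rewrite pconj_homE; case: ifP => _; last by rewrite conjg1.
by rewrite conjgE invgK mulgA.
Qed.

Lemma frame1_factor psi : frame psi (fun=> 1) ->
  exists phi : factor_auts S, psi = factor_aut phi.
Proof.
move=> psi1; have Spsi i a : elts (S i) a <-> elts (S i) (psi a).
  by have := psi1 i a; rewrite invg1 conjg1.
have ex i : {f : aut (S i) | forall a, \val (f a) = psi (\val a)}.
  apply: cid; pose f (a : S i) : S i :=
    SubgroupElt (mem_set ((Spsi i (\val a)).1 (elts_val a))).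
  have fM : {morph f : a b / a * b}.
    move=> a b; apply: val_inj.
    transitivity (psi (\val a * \val b)); last exact: gmulfM.
    by congr (psi _).
  have fb : bijective (hom_of_mul fM).
    have [g gK Kg] := aut_bij psi.
    have Sg (b : S i) : elts (S i) (g (\val b)).
      by apply: (Spsi i _).2; rewrite Kg; exact: elts_val.
    exists (fun b => SubgroupElt (mem_set (Sg b))) => a; apply: val_inj.
      exact: gK.
    exact: Kg.
  by exists (Aut fb).
exists (fun i => sval (ex i)); apply: fs_aut_eq => i a.
exact: etrans (esym (svalP (ex i) a)) (esym (factor_homE (fun i => sval (ex i)) a)).
Qed.

Hypothesis S_nontrivial : forall i, exists x : S i, x <> 1.

Lemma nontrivial_elts i : exists2 a, elts (S i) a & a <> 1.
Proof.
have [a a1] := S_nontrivial i; exists (\val a); first exact: elts_val.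
by move=> av; apply: a1; apply: val_inj; rewrite av.
Qed.

(** Malnormality: [x i * (y i)^-1] conjugates a nontrivial element of [S i] into [S i]. *)
Lemma frame_uniq psi x y : frame psi x -> frame psi y ->
  forall i, elts (S i) (x i * (y i)^-1).
Proof.
move=> px py i; have [a Sa a1] := nontrivial_elts i.
apply: (@malnormal _ _ S i (psi a ^ (x i)^-1)).
- exact: (px i a).1.
- by apply/eqP; rewrite conjg_eq1 gmulf_eq1 //; [exact/eqP|exact: bij_inj (aut_bij psi)].
- by rewrite -conjgM mulKg; exact: (py i a).1.
Qed.

(* The equivariant map of Bass-Serre trees induced by [psi] is locally
   injective, hence has no room to be onto unless all [x i] are trivial. *)
Lemma frame_rigid psi x : frame psi x ->
  (forall i, seg S (Some i) None (len S (x i)) (x i)) ->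
  (forall i j, i != j -> exists n, seg S (Some i) (Some j) n (x i * (x j)^-1)) ->
  forall i, x i = 1.
Proof.
move=> px sx sxx.
(* Local injectivity: for [g] with first letter in [S i], the element [x i * psi g] starts with a
   nontrivial letter of [S i]. The connecting words [x i * (x k)^-1] given by [sxx] keep the images
   of successive letters from cancelling. *)
have psi_seg o p n g : seg S o p n g -> g = 1 \/ exists i c h m,
    [/\ Some i != o, elts (S i) c /\ c <> 1, x i * psi g = c * h
      & seg S (Some i) None m h].
  elim=> {o p n g} [|o p i n a g io Sa a1 _ IHg]; first by left.
  right; exists i, (psi a ^ (x i)^-1); have Spa := (px i a).1 Sa.
  have pa1 : psi a ^ (x i)^-1 <> 1.
    by apply/eqP; rewrite conjg_eq1 gmulf_eq1 //; [exact/eqP|exact: bij_inj (aut_bij psi)].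
  have pE : x i * psi (a * g) = psi a ^ (x i)^-1 * (x i * psi g).
    by rewrite gmulfM conjgE invgK !mulgA mulgVK.
  case: IHg => [g1|[k [c [h [m [ki [Sc c1] ckh sh]]]]]].
    by exists (x i), (len S (x i)); rewrite pE g1 gmulf1 mulg1.
  have [l sl] := sxx i k ltac:(by rewrite -(inj_eq Some_inj) eq_sym).
  exists (x i * psi g), (l + m).+1; split=> //.
  by rewrite -(mulgVK (x k) (x i)) -mulgA ckh mulgA; apply: (@seg_cat _ _ _ _ k).
(* Surjectivity: applied to the preimage of [s], the claim makes [(x k)^-1 * c * h] the reduced form
   of a single letter. Hence [x k] and [h] are trivial, [s] equals [c], and [k] is [i]. *)
move=> i; have [s Ss s1] := nontrivial_elts i.
have [f fK Kf] := aut_bij psi.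
have := psi_seg _ _ _ _ (len_seg S (f s)); case=> [fs1|].
  by case: s1; rewrite -(Kf s) fs1 gmulf1.
move=> [k [c [h [m [_ [Sc c1]]]]]]; rewrite Kf => ks sh.
have sE : s = (x k)^-1 * c * h by rewrite -mulgA -ks mulKg.
have := seg_cat (seg_inv (sx k)) Sc c1 sh; rewrite -sE => /seg_len.
rewrite (len_letter Ss s1) => -[/esym/eqP]; rewrite addn_eq0 => /andP[/eqP xk0 /eqP m0].
move: sE sh; rewrite m0 (len_eq0 xk0) invg1 mul1g => + /seg_size0 h1; rewrite h1 mulg1 => sc.
have [->|ik] := eqVneq i k; first exact: (len_eq0 xk0).
by case: s1; apply: (factor_inter ik Ss); rewrite sc.
Qed.
End Frames.

(** * Combinatorics of three indices *)

Lemma perm_I3 (i j k : 'I_3) : uniq [:: i; j; k] -> perm_eq (enum 'I_3) [:: i; j; k].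
Proof.
move=> ijk; rewrite perm_sym; apply: uniq_perm => //; first exact: enum_uniq.
apply: (uniq_min_size ijk _ _).2 => [t _|]; first exact: mem_enum.
by rewrite size_enum_ord.
Qed.

Lemma sum_I3 (F : 'I_3 -> nat) i j k : uniq [:: i; j; k] ->
  \sum_t F t = (F i + F j + F k)%N.
Proof.
move=> ijk; rewrite -big_enum (perm_big _ (perm_I3 ijk)) !big_cons big_nil /=; lia.
Qed.

Lemma I3_cases (i j k t : 'I_3) : uniq [:: i; j; k] -> [\/ t = i, t = j | t = k].
Proof.
move=> /perm_I3/perm_mem/(_ t); rewrite mem_enum !inE => /esym/or3P[]/eqP->.
- exact: Or31.
- exact: Or32.
- exact: Or33.
Qed.

Lemma uniq_ordS (i : 'I_3) : uniq [:: i; ordS i; ordS (ordS i)].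
Proof. by case: i => [[|[|[|]]]]. Qed.

Lemma uniq3 (T : eqType) (i j k : T) : uniq [:: i; j; k] = [&& i != j, i != k & j != k].
Proof. by rewrite /= !inE negb_or andbT andbA. Qed.

Lemma I3_third (i j : 'I_3) : i != j -> exists k, uniq [:: i; j; k].
Proof.
move=> ij; case: (I3_cases j (uniq_ordS i)) => jE; first by rewrite jE eqxx in ij.
  by rewrite jE; exists (ordS (ordS i)); exact: uniq_ordS.
exists (ordS i); have := uniq_ordS i; rewrite jE !uniq3 => /and3P[-> -> n].
by rewrite eq_sym n.
Qed.

(** * Three factors: generation by shortening frames, then injectivity by centered frames *)

Section Splitting3.
Variables (G : groupType) (S : free_splitting 'I_3 G).
Implicit Types (psi : aut G) (x y : 'I_3 -> G).

(* The lift to [aut G] of the candidate isomorphism from [G] onto [gen A]. *)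
Definition theta : hom G (aut G) :=
  fs_ext (fun i => hom_of_mul (@pconj_autM _ _ S i (ordS i) (ordS_neq i))).

Lemma thetaE i (a : S i) : theta (\val a) = pconj_aut (ordS_neq i) a.
Proof. exact: (fs_extE (fun i => hom_of_mul (@pconj_autM _ _ S i (ordS i) (ordS_neq i)))). Qed.

Lemma frame_theta i c : elts (S i) c ->
  frame S (theta c) (fun k => if k == ordS i then c^-1 else 1).
Proof. by move=> /eltsP[a <-]; rewrite thetaE; exact: frame_pconj. Qed.

(** Since [psi c] lies in [S i ^ x i], this move turns the point of [ordS i] around the point of [i]
    and leaves the two other points in place. *)
Lemma frame_thetaM i c psi x : elts (S i) c -> frame S psi x ->
  frame S (theta c * psi) (fun k => if k == ordS i then x k * (psi c)^-1 else x k).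
Proof.
move=> Sc px; apply: frame_ext (frame_mul (frame_theta Sc) px) => k /=.
by case: ifP; rewrite ?gmulfV // gmulf1 mulg1.
Qed.

Hypothesis S_nontrivial : forall i, exists x : S i, x <> 1.

Definition factorizable psi :=
  exists g (phi : factor_auts S) u, psi = theta g * factor_aut phi * inner u.

Lemma factorizable_inner psi u : factorizable (psi * inner u) -> factorizable psi.
Proof.
move=> [g [phi [v E]]]; exists g, phi, (v * u^-1).
by rewrite innerM innerV mulgA -E mulgK.
Qed.

Lemma factorizable_theta psi c : factorizable (theta c * psi) -> factorizable psi.
Proof.
move=> [g [phi [v E]]]; exists (c^-1 * g), phi, v.
by rewrite gmulfM gmulfV -!mulgA (mulgA (theta g)) -E mulKg.
Qed.

(** Induction on the total length of the conjugators: strip them to shortest coset representatives,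
    then fold pairs. When neither is possible, [frame_rigid] applies. *)
Lemma frame_factorizable psi x : frame S psi x -> factorizable psi.
Proof.
have [m] := ubnP (\sum_k len S (x k)).
elim: m psi x => // m IHm psi x; rewrite ltnS => xm px.
have [[i xi]|strip] := pselect (exists i, exists c h,
    [/\ elts (S i) c, x i = c * h & len S h < len S (x i)]).
  move: xi => [c [h [Sc xE hx]]].
  have Sc' k : elts (S k) (if k == i then c^-1 else 1).
    by case: eqVneq => [->|_]; [exact: subgroupV|exact: subgroup1].
  apply: IHm (frame_shift Sc' px); apply: leq_trans xm.
  rewrite (bigD1 i) //= [ltnRHS](bigD1 i) //= eqxx {1}xE mulKg -addSn.
  apply: leq_add => //; apply: leq_sum => k /negPf ->.
  by rewrite mul1g.
have sx i : seg S (Some i) None (len S (x i)) (x i).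
  have [c [h [Sc xE sh [hx|c1]]]] := seg_strip S i (x i).
    by case: strip; exists i, c, h.
  by move: sh; rewrite xE c1 mul1g.
have sumE i j (ij : i != j) : exists2 k, uniq [:: i; j; k] &
    forall F : 'I_3 -> nat, \sum_t F t = (F i + F j + F k)%N.
  by have [k ijk] := I3_third ij; exists k => // F; exact: sum_I3.
have inner_lt u : \sum_k len S (x k * u^-1) < \sum_k len S (x k) -> factorizable psi.
  move=> xu; apply: (@factorizable_inner _ u^-1).
  apply: IHm (frame_inner u^-1 px); exact: leq_trans xu xm.
(* The point of [i] is the base point, and turning by [u^-1] around it brings the point of [j]
   nearer. For [j = ordS i], the turn is [theta (f u)], where [f u] is the preimage of [u] under
   [psi]. *)
have fold_center i j u : i != j -> x i = 1 -> elts (S i) u ->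
    len S (x j * u^-1) < len S (x j) -> factorizable psi.
  move=> ij xi Su ju; have [f fK Kf] := aut_bij psi.
  have Sfu : elts (S i) (f u) by apply: (px i _).2; rewrite Kf xi invg1 conjg1.
  case: (I3_cases j (uniq_ordS i)) => jE; first by rewrite jE eqxx in ij.
    apply: (@factorizable_theta _ (f u)).
    apply: IHm (frame_thetaM Sfu px); apply: leq_trans xm.
    rewrite (bigD1 j) //= [ltnRHS](bigD1 j) //= -jE eqxx Kf -addSn.
    by apply: leq_add => //; apply: leq_sum => k /negPf ->.
  (* [j = ordS (ordS i)]: conjugating by [u^-1] shortens [x j] but disturbs
     [x (ordS i)], which [theta] repairs. *)
  apply: (@factorizable_inner _ u^-1); apply: (@factorizable_theta _ (f u)^-1).
  have Sfu' := subgroupV Sfu.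
  (* The conjugation turns [x i = 1] into [u^-1], which is in [S i]; the shift by [u] makes it
     trivial again. *)
  pose c k := if k == i then u else 1.
  have Sc k : elts (S k) (c k).
    by rewrite /c; case: eqVneq => [->|_]; [exact: Su|exact: subgroup1].
  apply: IHm (frame_shift Sc (frame_thetaM Sfu' (frame_inner u^-1 px))).
  apply: leq_trans xm; rewrite !(sum_I3 _ (uniq_ordS i)) /= /c !eqxx.
  have := uniq_ordS i; rewrite uniq3 => /and3P[/negPf n1 /negPf n2 /negPf n3].
  rewrite n1 ![_ == i]eq_sym n1 n2 [_ == ordS i]eq_sym n3 xi !mul1g mulgV -jE.
  have -> : inner_fun u^-1 (psi (f u)^-1) = u^-1.
    by rewrite gmulfV Kf /inner_fun conjgE invgK mulVKg.
  rewrite invgK mulgVK; lia.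
have [[i [j [ij nij]]]|sxx] := pselect (exists i j, i != j /\
    ~ exists n, seg S (Some i) (Some j) n (x i * (x j)^-1)).
  case: (fold_pair ij (sx i) (sx j)) => [//|[k [u [Su iu ju]]]|[xi [u Su ju]]|[xj [u Su iu]]].
  (* Two lengths drop by at least one and the third grows by at most one, so the sum decreases. *)
  - have [t _ sumE'] := sumE _ _ ij; apply: (inner_lt u); rewrite !sumE'.
    have := len_mul_letter (x t) (subgroupV Su); lia.
  - exact: (fold_center i j u).
  - by apply: (fold_center j i u) => //; rewrite eq_sym.
have x1 : forall i, x i = 1.
  apply: frame_rigid px sx _ => // i j ij.
  by case: (pselect (exists n, seg S (Some i) (Some j) n (x i * (x j)^-1))) => // n;
    case: sxx; exists i, j.
have [phi ->] := frame1_factor (frame_ext x1 px).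
by exists 1, phi, 1; rewrite gmulf1 inner1 mul1g mulg1.
Qed.

(* The point fixed by [psi (S i)] lies strictly inside the geodesic joining the
   points fixed by the images of the two other factors. *)
Definition centered i psi := exists x j k r a s n m,
  [/\ frame S psi x, uniq [:: j; i; k], elts (S i) a /\ a <> 1,
      seg S (Some j) (Some i) n r /\ seg S (Some i) (Some k) m s &
      x j = r * x i /\ x i = a * s * x k].

(** Either outer point can be taken as the first one: the path is read backwards, and shifting [x i]
    by [a^-1] carries the turn at the middle point to the other half. *)
Lemma centered_sym i j psi : centered i psi -> i != j -> exists x k r a s n m,
  [/\ frame S psi x, uniq [:: j; i; k], elts (S i) a /\ a <> 1,
      seg S (Some j) (Some i) n r /\ seg S (Some i) (Some k) m s &
      x j = r * x i /\ x i = a * s * x k].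
Proof.
move=> [x [l [k [r [a [s [n [m [px lik [Sa a1] [sr ss] [xl xi]]]]]]]]]] ij.
case: (I3_cases j lik) => jE; first by subst l; exists x, k, r, a, s, n, m.
  by rewrite jE eqxx in ij.
subst k; pose c t := if t == i then a^-1 else 1.
have Sc t : elts (S t) (c t).
  by rewrite /c; case: eqVneq => [->|_]; [exact: subgroupV|exact: subgroup1].
move: lik; rewrite uniq3 => /and3P[li lj _].
exists (fun t => c t * x t), l, s^-1, a^-1, r^-1, m, n; split.
- exact: frame_shift.
- by rewrite uniq3 eq_sym ij eq_sym lj eq_sym li.
- by split; [exact: subgroupV|exact: invg_neq1].
- by split; exact: seg_inv.
rewrite /c eqxx [j == i]eq_sym (negPf ij) (negPf li) !mul1g; split.
  by rewrite xi -!mulgA !mulKg.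
by rewrite xl mulgA mulgVK.
Qed.

Lemma centered_theta i c : elts (S i) c -> c <> 1 -> centered i (theta c).
Proof.
move=> Sc c1; have := uniq_ordS i; rewrite uniq3 => /and3P[n1 n2 n3].
exists (fun k => if k == ordS i then c^-1 else 1), (ordS (ordS i)), (ordS i), 1, c, 1, 0, 0.
split.
- exact: frame_theta.
- by rewrite uniq3 eq_sym n2 eq_sym n3 n1.
- by [].
- by split; apply: seg0; rewrite (inj_eq Some_inj) ?n1 // eq_sym n2.
- by rewrite eqxx (negPf n1) eq_sym (negPf n3) !mulg1 mulgV.
Qed.

(** Before the move, the path runs from [i] through [l] to [k]. The move turns the endpoint [k] or
    the middle [l], whichever is [ordS i], around [i], so that [i] becomes the new middle. *)
Lemma centered_thetaM i l c psi : elts (S i) c -> c <> 1 -> l != i ->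
  centered l psi -> centered i (theta c * psi).
Proof.
move=> Sc c1 li /centered_sym/(_ li).
move=> [x [k [r [a [s [n [m [px ilk [Sa a1] [sr ss] [xi xl]]]]]]]]].
have := frame_thetaM Sc px; set x' := (fun t => _) => px'.
(* [b] is the turn at the point of [i]: the move replaces the conjugator [y] of [ordS i] by
   [y * (psi c)^-1]. *)
pose b := psi c ^ (x i)^-1; have Sb : elts (S i) b by exact: (px i c).1.
have b1 : b <> 1.
  by apply/eqP; rewrite conjg_eq1 gmulf_eq1 //; [exact/eqP|exact: bij_inj (aut_bij psi)].
have bE : (psi c)^-1 = (x i)^-1 * b^-1 * x i.
  by rewrite -mulgA -conjgE -conjVg -conjgM mulVg conjg1.
have srs := seg_cat sr Sa a1 ss.
have xik : x i = r * a * s * x k by rewrite xi xl !mulgA.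
have := uniq_ordS i; rewrite uniq3 => /and3P[n1 _ _].
move: (ilk); rewrite uniq3 => /and3P[il ik lk].
have x'i : x' i = x i by rewrite /x' (negPf n1).
have tE : ordS i = k \/ ordS i = l.
  case: (I3_cases (ordS i) ilk); [|by right|by left].
  by move/eqP: n1 => + /esym.
case: tE => tE.
- exists x', l, k, r^-1, b, (r * a * s), n, (n + m).+1; split=> //.
  + by rewrite uniq3 eq_sym il lk ik.
  + by split; first exact: seg_inv.
  rewrite x'i /x' tE eqxx (negPf lk); split; first by rewrite xi mulKg.
  by rewrite mulgA -(mulgA b) -xik bE !mulgA mulgK mulgV mul1g.
- exists x', k, l, (r * a * s)^-1, b, r, (n + m).+1, n; split=> //.
  + by rewrite uniq3 eq_sym ik eq_sym lk il.
  + by split; first exact: seg_inv.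
  rewrite x'i /x' tE eqxx eq_sym (negPf lk); split; first by rewrite {1}xik mulKg.
  by rewrite mulgA -(mulgA b) -xi bE !mulgA mulgK mulgV mul1g.
Qed.

(** Reading a normal form from its last letter to its first, each letter moves the center to its own
    factor; consecutive letters have different factors, as [centered_thetaM] requires. *)
Lemma theta_centered o p n g : seg S o p n g -> g = 1 \/
  exists2 i, Some i != o & centered i (theta g).
Proof.
elim=> {o p n g} [|o p i n c g io Sc c1 _ IHg]; first by left.
right; exists i => //; rewrite gmulfM.
case: IHg => [->|[l li gl]]; first by rewrite gmulf1 mulg1; exact: centered_theta.
by apply: centered_thetaM gl => //; rewrite -(inj_eq Some_inj).
Qed.

(** With constant conjugators, [r * a * s = x j * (x k)^-1] would be a product of an element of
    [S j] and one of [S k], which forces length zero; but the word contains [a]. *)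
Lemma centered_not_const i psi u : centered i psi -> ~ frame S psi (fun=> u).
Proof.
move=> [x [j [k [r [a [s [n [m [px jik [Sa a1] [sr ss] [xj xi]]]]]]]]]] pu.
have Sx t := frame_uniq S_nontrivial px pu t.
have := seg_mul_letters (seg_cat sr Sa a1 ss) (Sx j) (subgroupV (Sx k)).
rewrite -addnS => /(_ _)/eqP; rewrite addn_eq0 andbF => E; apply: notF; apply: E.
by rewrite invgF mulgA mulgVK xj xi -!mulgA mulgV mulg1.
Qed.

Lemma theta_factor_inner g (phi : factor_auts S) u :
  theta g = factor_aut phi * inner u -> g = 1.
Proof.
have [//|[i _ gi] E] := theta_centered (len_seg S g).
case: (centered_not_const gi (u := u)); rewrite E.
by apply: frame_ext (frame_inner u (frame_factor phi)) => i'; rewrite mul1g.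
Qed.

(** The constant frames [1] and [u] of one automorphism put [u^-1] in every factor, and distinct
    factors meet trivially. *)
Lemma factor_aut_inner (phi : factor_auts S) u : factor_aut phi = inner u -> phi = 1.
Proof.
move=> E; have u1 : u^-1 = 1.
  have Su i : elts (S i) u^-1.
    rewrite -[u^-1]mul1g; apply: (frame_uniq S_nontrivial (frame_factor phi) (y := fun=> u)).
    rewrite E -[inner u]mul1g; apply: (frame_ext _ (frame_inner u (x := fun=> 1) _)) => [k|].
      by rewrite mul1g.
    by move=> k a; rewrite invg1 conjg1.
  exact: (factor_inter (ordS_neq ord0) (Su _) (Su _)).
apply: functional_extensionality_dep => i; apply: aut_eq => a; apply: val_inj.
rewrite -(factor_homE phi a).
transitivity (factor_aut phi (\val a)) => //.
by rewrite E /= /inner_fun -[u]invgK u1 invg1 conjg1.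
Qed.

(** The semidirect product relation already holds in [aut G]; it is enough to check it on letters,
    factor by factor. *)
Lemma theta_factor g (phi : factor_auts S) :
  theta g * factor_aut phi = factor_aut phi * theta (factor_aut phi g).
Proof.
move: g; apply: splitting_ind => [|i _ g /eltsP[a <-] IHg].
  by rewrite !gmulf1 mul1g mulg1.
rewrite !gmulfM -mulgA IHg !mulgA; congr (_ * _).
have -> : factor_aut phi (\val a) = \val (phi i a) by exact: factor_homE.
rewrite !thetaE; apply: fs_aut_eq => k y.
transitivity (factor_hom phi (if k == ordS i then \val a * \val y * (\val a)^-1 else \val y)).
  exact: (congr1 (factor_hom phi) (pconj_homE (ordS i) a y)).
transitivity (pconj_hom (ordS i) (phi i a) (\val (phi k y))); last first.
  exact: (congr1 (pconj_hom (ordS i) (phi i a)) (esym (factor_homE phi y))).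
apply: etrans (esym (pconj_homE (ordS i) (phi i a) (phi k y))).
have fE l (z : S l) : factor_hom phi (\val z) = \val (phi l z) by exact: factor_homE.
by case: ifP => _; rewrite ?gmulfM ?gmulfV !fE.
Qed.

End Splitting3.

(** * Corestriction, and transport of a free product along a bijection *)

Lemma inj_surj_bij (T U : Type) (f : T -> U) :
  injective f -> (forall u, exists t, f t = u) -> bijective f.
Proof.
move=> finj /boolp.choice[g fg]; exists g => // t; exact: finj.
Qed.

Section Corestriction.
Variables (G H : groupType) (f : hom G H) (K : subgroup H).
Hypothesis fK : forall x, elts K (f x).

Lemma corestr_mul : {morph (fun x => SubgroupElt (mem_set (fK x))) : x y / x * y}.
Proof.
move=> x y; apply: val_inj; set a := SubgroupElt (mem_set (fK x)).
set b := SubgroupElt (mem_set (fK y)).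
transitivity (subgroup_val K (a * b)) => //.
by rewrite (gmulfM (s := subgroup_val K)) /= gmulfM.
Qed.
Definition corestr : hom G K := hom_of_mul corestr_mul.
End Corestriction.

(** A map out of [P] is the inverse of [F] followed by the extension to [G] of the maps
    [f i \o e i]. *)
Lemma free_product_bij (I : eqType) (G : groupType) (S : free_splitting I G)
    (B : I -> groupType) (P : groupType) (iota : forall i, hom (B i) P)
    (F : hom G P) (e : forall i, hom (S i) (B i)) :
  bijective F -> (forall i b, exists a, e i a = b) ->
  (forall i a, F (\val a) = iota i (e i a)) -> is_free_product iota.
Proof.
move=> [F' FK KF] e_surj Fe H f.
pose k : hom G H := fs_ext (fun i => f i \o e i : hom _ _).
have F'M : {morph F' : x y / x * y} by move=> x y; apply: (canLR FK); rewrite gmulfM !KF.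
exists (k \o hom_of_mul F'M : hom _ _); split=> [i b|h hf].
  have [a <-] := e_surj i b; rewrite -Fe /= FK.
  exact: (fs_extE (fun i => f i \o e i : hom _ _) a).
apply: hom_eq => p; rewrite -(KF p); set g := F' p.
have E : k = (h \o F : hom _ _).
  apply: fs_hom_eq => i a.
  transitivity (f i (e i a)); first exact: (fs_extE (fun i => f i \o e i : hom _ _) a).
  by rewrite /= Fe hf.
by rewrite /= FK E.
Qed.

(** * Passage to outer classes and the semidirect decomposition *)

Section Main.
Variables (G : groupType) (S : free_splitting 'I_3 G).
Hypothesis S_nontrivial : forall i, exists x : S i, x <> 1.

Let A (i : 'I_3) : subgroup (Out G) := pconj_group S (ordS_neq i).
Let N : subgroup (Out G) := gen A.

Definition otheta : hom G (Out G) := @out G \o theta S.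

Lemma outP (f g : aut G) : out f = out g <-> exists a, g = f * inner a.
Proof. by split=> [/eqP/out_piP|fg]; [|apply/eqP/out_piP]. Qed.

Lemma otheta_pconj i (a : S i) : otheta (\val a) = pconj (ordS_neq i) a.
Proof. by rewrite /= thetaE. Qed.

Lemma otheta_pure g : elts (pure_out S) (otheta g).
Proof.
move: g; apply: (splitting_ind (S := S)) => [|i x g Sx IHg].
  by rewrite gmulf1; exact: subgroup1.
rewrite gmulfM; apply: subgroupM => //; apply/pure_outP.
exists (theta S x), (fun k => if k == ordS i then x^-1 else 1).
by split; last exact: frame_theta.
Qed.

Lemma factor_out_pure phi : elts (pure_out S) (factor_out S phi).
Proof.
by apply/pure_outP; exists (factor_aut phi), (fun=> 1); split; last exact: frame_factor.
Qed.

(** The image of [otheta] contains each generating subgroup, and [splitting_ind] gives the other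
    inclusion. *)
Lemma gen_otheta c : elts N c <-> exists g, otheta g = c.
Proof.
split=> [Nc|[g <-]].
  suff [g _ <-] : elts (im otheta) c by exists g.
  by apply: Nc => i _ [a _ <-]; exists (\val a) => //; exact: otheta_pconj.
move: g; apply: (splitting_ind (S := S)) => [|i _ g /eltsP[a <-] Ng].
  by rewrite gmulf1; exact: subgroup1.
rewrite gmulfM; apply: subgroupM => //; apply: (sub_gen A i).
by exists a => //; exact/esym/otheta_pconj.
Qed.

Lemma otheta_factor g phi :
  otheta g * factor_out S phi = factor_out S phi * otheta (factor_act S phi g).
Proof. by rewrite -!(gmulfM (s := @out G)) theta_factor. Qed.

(** This single statement yields injectivity of both maps and the trivial intersection of their
    images. *)
Lemma otheta_eq_factor g phi : otheta g = factor_out S phi -> g = 1 /\ phi = 1.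
Proof.
move=> E; have [u uE] := (outP _ _).1 (esym E).
have g1 := theta_factor_inner S_nontrivial uE; split=> //.
apply: (factor_aut_inner S_nontrivial (u := u^-1)).
by rewrite innerV; apply: (mulIg (inner u)); rewrite mulVg -uE g1 gmulf1.
Qed.

Lemma otheta_inj : injective otheta.
Proof.
apply: gmulf_inj => g g1; have [] // := @otheta_eq_factor g 1.
by rewrite g1 gmulf1.
Qed.

Lemma factor_out_inj : injective (factor_out S).
Proof.
apply: gmulf_inj => phi phi1; have [] // := @otheta_eq_factor 1 phi.
by rewrite phi1 gmulf1.
Qed.

Lemma pure_out_decomp c : elts (pure_out S) c ->
  exists g phi, c = otheta g * factor_out S phi.
Proof.
move=> /pure_outP[psi [x [-> /(frame_factorizable S_nontrivial)[g [phi [u ->]]]]]].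
exists g, phi; rewrite -(gmulfM (s := @out G)).
by apply/esym/outP; exists u.
Qed.

(** The factor automorphism comes first because a pair [(h, n)] stands for [h * n]. *)
Definition sdprod_map (u : sdprod (factor_act S)) : Out G :=
  factor_out S u.1 * otheta u.2.

Lemma sdprod_mapM : {morph sdprod_map : u v / u * v}.
Proof.
move=> u v; rewrite /sdprod_map /= !gmulfM -!mulgA; congr (_ * _).
by rewrite !mulgA otheta_factor.
Qed.

Lemma sdprod_map_pure u : elts (pure_out S) (hom_of_mul sdprod_mapM u).
Proof. by apply: subgroupM; [exact: factor_out_pure | exact: otheta_pure]. Qed.

End Main.

Theorem corollary4p3p2 (G : groupType) (S : free_splitting 'I_3 G)
    (S_nontrivial : forall i : 'I_3, exists x : S i, x <> 1) :
  let A (i : 'I_3) : subgroup (Out G) := pconj_group S (ordS_neq i) in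
  let N : subgroup (Out G) := gen A in
  [/\ is_free_product (fun i => incl (sub_gen A i) : hom (A i) N),
      injective (factor_out S),
      is_sdprod (pure_out S) N (im (factor_out S)) &
      isomorphic (sdprod (factor_act S)) (pure_out S)].
Proof.
move=> A N; split.
(* Corestricted to [N], [otheta] is an isomorphism from [G] taking [S i] onto [A i], so it carries
   the given splitting over. *)
- have NF g : elts N (otheta S g) by apply/gen_otheta; exists g.
  have AP i (x : S i) : elts (A i) (pconj (ordS_neq i) x) by exists x.
  apply: (free_product_bij (S := S) (F := corestr NF) (e := fun i => corestr (AP i))).
  + apply: inj_surj_bij => [g h /(congr1 \val)|c]; first exact: otheta_inj.
    have [g gc] := (gen_otheta S _).1 (elts_val c); exists g; exact: val_inj.
  + by move=> i b; have [a _ ab] := elts_val b; exists a; apply: val_inj.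
  + by move=> i a; apply: val_inj; exact: otheta_pconj.
- exact: factor_out_inj.
- split; first split.
  + by move=> c /gen_otheta[g <-]; exact: otheta_pure.
  + by move=> c [phi _ <-]; exact: factor_out_pure.
  (* Normality: the part of [l] in [N] preserves [N], and its factor part acts on [otheta g] by
     replacing [g] with [factor_act S phi g]. *)
  + move=> n l Nn /(pure_out_decomp S_nontrivial)[h [phi ->]].
    have Nh : elts N (otheta S h) by apply/gen_otheta; exists h.
    rewrite conjgM; have /gen_otheta[g <-] := subgroupJ Nn Nh.
    by apply/gen_otheta; exists (factor_act S phi g); rewrite conjgE otheta_factor mulKg.
  + move=> c /gen_otheta[g <-] [phi _ /esym/(otheta_eq_factor S_nontrivial)[-> _]].
    by rewrite gmulf1.
  + move=> c /(pure_out_decomp S_nontrivial)[g [phi ->]].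
    exists (otheta S g), (factor_out S phi); split=> //; last by exists phi.
    by apply/gen_otheta; exists g.
- exists (corestr (sdprod_map_pure (S := S))); apply: inj_surj_bij => [|c].
    apply: gmulf_inj => -[phi g] /(congr1 \val) E.
    have {}E : factor_out S phi * otheta S g = 1 by [].
    have [->] : g = 1 /\ phi^-1 = 1.
      apply: otheta_eq_factor => //; apply: (mulgI (factor_out S phi)).
      by rewrite E gmulfV mulgV.
    by move/eqP; rewrite invg_eq1 => /eqP ->.
  have [g [phi E]] := pure_out_decomp S_nontrivial (elts_val c).
  (* Moving [phi] to the left of [otheta g] twists [g] by [phi]. *)
  by exists (phi, factor_act S phi g); apply: val_inj; rewrite E otheta_factor.
Qed.
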